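(* For every non-empty set $\mathbb{M} \subset \mathbb{T}$ and every $n \in \mathbb{N}$, \[ s_{\mathbb{M}}(n) \ \le \ \binom{n}{3} - \binom{\lfloor n/2 \rfloor}{3} - \binom{\lceil n/2 \rceil}{3}. \]
   Context: $\mathbb{N} = \{0,1,2,\dots\}$ and $\mathbb{T} := \{3\} \cup (\mathbb{N} \setminus 3\mathbb{N})$, where $3\mathbb{N} = \{3k : k \in \mathbb{N}\}$; that is, $\mathbb{T}$ consists of $3$ together with all natural numbers not divisible by $3$. The inclusion $\mathbb{M} \subset \mathbb{T}$ is not necessarily strict. For a non-empty set $\mathbb{M} \subset \mathbb{T}$ and a finite set $A \subset \mathbb{M}$, define \[ S_{\mathbb{M}}(A) := \mathbb{M} \cap \{a+b+c : a,b,c \in A,\ a<b<c\}, \] and for $n \in \mathbb{N}$ define \[ s_{\mathbb{M}}(n) := \max\{|S_{\mathbb{M}}(A)| : A \subset \mathbb{M},\ |A| = n\}, \] with the convention that the maximum of the empty set is $0$ (relevant only when $\mathbb{M}$ is finite with fewer than $n$ elements). Binomial coefficients satisfy $\binom{m}{3} = 0$ for $m \in \{0,1,2\}$. *)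

(* Defs.v *)
From mathcomp Require Import all_boot all_order finmap.
From mathcomp Require Import boolp classical_sets functions cardinality.

Set Implicit Arguments.
Unset Strict Implicit.
Unset Printing Implicit Defensive.

Local Open Scope classical_set_scope.

Definition TT : set nat :=
  [set 3] `|` ([set: nat] `\` [set 3 * k | k in [set: nat]]).

Definition sum_set (M : set nat) (A : {fset nat}) : set nat :=
  M `&` [set x | exists a b c : nat,
    [/\ a \in A, b \in A & c \in A] /\ a < b < c /\ x = a + b + c].

Definition sum_cards (M : set nat) (n : nat) : set nat :=
  [set #|` fset_set (sum_set M A)| |
    A in [set A : {fset nat} | [set` A] `<=` M /\ #|` A| = n]].

(* [E `&` ubound E] contains at most one element, the greatest element of E.
   The value is 0 if E is empty, and also if E is unbounded; the latter does not
   occur for [sum_cards M n], see [sum_cards_ubound]. *)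
Definition max_set (E : set nat) : nat := xget 0 (E `&` ubound E).

Definition smax (M : set nat) (n : nat) : nat := max_set (sum_cards M n).

Lemma sum_set_sub (M : set nat) (A : {fset nat}) :
  sum_set M A `<=`
  [set` [fset (x + y)%N | x in A, y in [fset (a + b)%N | a in A, b in A]]%fset].
Proof.
move=> x [_ [a [b [c [[aA bA cA] [_ ->]]]]]] /=.
rewrite -addnA; apply/imfset2P; exists a => //; exists (b + c) => //.
by apply/imfset2P; exists b => //; exists c.
Qed.

(* Hence [fset_set (sum_set M A)] really has the same elements as
   [sum_set M A]. *)
Lemma finite_sum_set (M : set nat) (A : {fset nat}) : finite_set (sum_set M A).
Proof. exact: sub_finite_set (@sum_set_sub M A) (finite_fset _). Qed.

Lemma sum_cards_ubound (M : set nat) (n : nat) :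
  ubound (sum_cards M n) (n * (n * n)).
Proof.
have card2 (A B : {fset nat}) :
    #|` [fset (x + y)%N | x in A, y in B]%fset| <= #|` A| * #|` B|.
  rewrite (_ : [fset (x + y)%N | x in A, y in B]%fset =
    seq_fset tt [seq x + y | x <- A, y <- B]); last first.
    apply/fsetP => z; rewrite seq_fsetE; apply/imfset2P/allpairsP.
      by move=> [x xA [y yB ->]]; exists (x, y).
    by move=> [[x y] /= [xA yB ->]]; exists x => //; exists y.
  rewrite size_seq_fset (leq_trans (size_undup _))//.
  by rewrite size_allpairs.
move=> _ [A [_ An] <-]; rewrite -{}An.
apply: (@leq_trans #|` [fset (x + y)%N | x in A,
    y in [fset (a + b)%N | a in A, b in A]]%fset|).
  apply: fsubset_leq_card; apply/fsubsetP => x.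
  rewrite in_fset_set; last exact: finite_sum_set.
  by rewrite inE => /sum_set_sub.
by apply: leq_trans (card2 _ _) _; rewrite leq_mul2l card2 orbT.
Qed.

Lemma smax_max (M : set nat) (n : nat) : sum_cards M n !=set0 ->
  sum_cards M n (smax M n) /\ ubound (sum_cards M n) (smax M n).
Proof.
move=> [m Em].
suff ex : exists m, (sum_cards M n `&` ubound (sum_cards M n)) m.
  by have [] := xgetPex 0 ex.
pose P k := `[< sum_cards M n k >].
have exP : exists k, P k by exists m; apply/asboolP.
have ubP k : P k -> k <= n * (n * n) by move=> /asboolP /sum_cards_ubound.
have [k /asboolP Ek kmax] := ex_maxnP exP ubP.
by exists k; split => // j Ej; apply: kmax; apply/asboolP.
Qed.

Lemma smax_empty (M : set nat) (n : nat) : sum_cards M n = set0 -> smax M n = 0.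
Proof. by move=> E0; rewrite /smax /max_set E0 set0I; apply: xgetPN => x []. Qed.

Lemma leq_bin3D (p q : nat) : 'C(p, 3) + 'C(q, 3) <= 'C(p + q, 3).
Proof.
elim: q => [|q IHq]; first by rewrite !addn0.
rewrite addnS !binS addnA leq_add//.
by rewrite leq_bin2l// leq_addl.
Qed.

(* The truncated subtractions in the bound on [smax] are genuine. *)
Lemma bin3_halves (n : nat) : 'C(n./2, 3) + 'C(uphalf n, 3) <= 'C(n, 3).
Proof.
have := leq_bin3D n./2 (uphalf n).
by rewrite uphalf_half addnCA addnn odd_double_half.
Qed.

(* Main.v *)
(** A sum of three distinct elements of [M] is at least [1 + 2 + 3], so it is
    not in [TT] when it is divisible by [3]. If [A] has [p] elements congruent
    to [1] and [q] congruent to [2] modulo [3], the excluded triples include all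
    those inside one of these two classes and, if [3] is in [A], the [p * q]
    triples made of [3] and one element of each class. Convexity of
    [p |-> 'C(p, 3)] then bounds their number below by its value at the balanced
    splitting of [n]. *)
Require Import Defs.
From mathcomp Require Import all_boot all_order finmap.
From mathcomp Require Import boolp classical_sets functions cardinality.
From mathcomp Require Import zify.

(** By Pascal's rule, each unit step of [d] adds ['C(p + d, 2)] on the left and the no smaller
    ['C(q + d, 2)] on the right. *)
Lemma bin3_exchange (p q d : nat) :
  p <= q -> 'C(p + d, 3) + 'C(q, 3) <= 'C(p, 3) + 'C(q + d, 3).
Proof.
move=> le_pq; elim: d => [|d IHd]; first by rewrite !addn0.
by rewrite !addnS !binS addnAC addnA leq_add// leq_bin2l// leq_add2r.
Qed.

Lemma leq_bin3_halves (p q : nat) :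
  'C((p + q)./2, 3) + 'C(uphalf (p + q), 3) <= 'C(p, 3) + 'C(q, 3).
Proof.
wlog le_pq : p q / p <= q.
  move=> th; case: (leqP p q) => [|/ltnW] /th //.
  by rewrite [q + p]addnC ['C(q, 3) + _]addnC.
have := @bin3_exchange p (uphalf (p + q)) ((p + q)./2 - p).
have -> : p + ((p + q)./2 - p) = (p + q)./2 by lia.
have -> : uphalf (p + q) + ((p + q)./2 - p) = q by lia.
by apply; lia.
Qed.

(** The additional element stands for the multiple of 3. Counting it in the smaller class, of size
    [p] say, costs ['C(p, 2)], which [p * q] covers. *)
Lemma leq_bin3_halvesS (p q : nat) :
  'C((p + q).+1./2, 3) + 'C(uphalf (p + q).+1, 3) <=
  'C(p, 3) + 'C(q, 3) + p * q.
Proof.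
wlog le_pq : p q / p <= q.
  move=> th; case: (leqP p q) => [|/ltnW] /th //.
  by rewrite [q + p]addnC [q * p]mulnC ['C(q, 3) + _]addnC.
have := leq_bin3_halves p.+1 q; rewrite addSn => /leq_trans; apply.
rewrite binS addnAC leq_add2l bin2.
have : p * p.-1 <= p * q by rewrite leq_mul2l; lia.
lia.
Qed.

Section ZeroSumTriples.
Variables (T : finType) (f : T -> nat).

Definition residue_class (r : nat) : {set T} := [set x | f x %% 3 == r]%SET.

Definition zero_sum_triples : {set {set T}} :=
  [set X : {set T} | (#|X| == 3) && (3 %| \sum_(x in X) f x)]%SET.

Definition triples_in (B : {set T}) : {set {set T}} :=
  [set X : {set T} | X \subset B & #|X| == 3]%SET.

Lemma triples_in_residue_class (r : nat) :
  triples_in (residue_class r) \subset zero_sum_triples.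
Proof.
apply/fintype.subsetP => X; rewrite !inE.
move=> /andP[/fintype.subsetP XB /[dup] /eqP X3 ->] /=.
rewrite /dvdn -modn_summ (eq_bigr (fun=> r)).
  by rewrite sum_nat_const X3 modnMr.
by move=> x /XB; rewrite inE => /eqP.
Qed.

Lemma disjoint_triples_in (B C : {set T}) :
  [disjoint B & C] -> [disjoint triples_in B & triples_in C].
Proof.
move=> /pred0P BC; apply/pred0P => X /=; rewrite !inE; apply/negbTE/negP.
move=> /andP[/andP[/fintype.subsetP XB /eqP X3] /andP[/fintype.subsetP XC _]].
have /card_gt0P[x xX] : 0 < #|X| by rewrite X3.
by have := BC x; rewrite /= XB// XC.
Qed.

Definition mixed_triples (t : T) : {set {set T}} :=
  [set [set t; u.1; u.2] |
    u in finset.setX (residue_class 1) (residue_class 2)]%SET.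

(** The residues 0, 1, 2 of the three members are distinct, so a mixed triple determines the pair it
    comes from. *)
Lemma card_mixed_triples (t : T) : 3 %| f t ->
  #|mixed_triples t| = #|residue_class 1| * #|residue_class 2|.
Proof.
move=> ft; rewrite -cardsX; apply: card_in_imset => -[a b] [c d].
rewrite !inE /= => /andP[/eqP fa /eqP fb] /andP[/eqP fc /eqP fd] /setP eqX.
have := eqX c; have := eqX d; rewrite !inE !eqxx !orbT.
move=> /orP[/orP[]|] /eqP ? /orP[/orP[]|] /eqP ?; subst => //; lia.
Qed.

Lemma mixed_triples_zero_sum (t : T) : 3 %| f t ->
  mixed_triples t \subset zero_sum_triples.
Proof.
move=> ft; apply/fintype.subsetP => X /imsetP[[a b]].
rewrite !inE /= => /andP[/eqP fa /eqP fb] ->.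
have tab : t \notin [set a; b]%SET.
  by rewrite !inE; apply/negP => /orP[] /eqP ?; subst; lia.
have ab : a \notin [set b]%SET.
  by rewrite !inE; apply/negP => /eqP ?; subst; lia.
rewrite -finset.setUA cardsU1 tab cardsU1 ab cards1 /= big_setU1//= big_setU1//=.
by rewrite big_set1; lia.
Qed.

(** The element [t] lies in every mixed triple, but its residue 0 keeps it out of the class of
    [r]. *)
Lemma disjoint_mixed_triples (t : T) (r : nat) : 3 %| f t -> 0 < r ->
  [disjoint triples_in (residue_class r) & mixed_triples t].
Proof.
move=> ft r_gt0; apply/pred0P => X /=; apply/negP => /andP[].
rewrite inE => /andP[/fintype.subsetP XB _] /imsetP[u _ eX].
by have := XB t; rewrite eX !inE eqxx => /(_ isT); lia.
Qed.

Lemma leq_card_zero_sum_triples : #|[set x | 3 %| f x]%SET| <= 1 ->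
  'C(#|T|./2, 3) + 'C(uphalf #|T|, 3) <= #|zero_sum_triples|.
Proof.
move=> le1.
have disj12 : [disjoint residue_class 1 & residue_class 2].
  by apply/pred0P => x /=; rewrite !inE; lia.
have cardT : #|T| = #|residue_class 1| + #|residue_class 2| +
    #|[set x | 3 %| f x]%SET|.
  have /eqP <- : #|residue_class 1 :|: residue_class 2|%SET ==
      #|residue_class 1| + #|residue_class 2| by rewrite leq_card_setU.
  rewrite -(cardsC (residue_class 1 :|: residue_class 2)%SET); congr (_ + _).
  by apply: eq_card => x; rewrite !inE; lia.
have cardU : #|triples_in (residue_class 1) :|: triples_in (residue_class 2)|%SET
    = 'C(#|residue_class 1|, 3) + 'C(#|residue_class 2|, 3).
  rewrite -!cards_draws; apply/eqP.
  by rewrite leq_card_setU disjoint_triples_in.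
have subU : triples_in (residue_class 1) :|: triples_in (residue_class 2)
    \subset zero_sum_triples.
  by rewrite finset.subUset !triples_in_residue_class.
(* If a multiple [t] of 3 exists, the mixed triples through it supply the product term; otherwise
   the two classes exhaust [T]. *)
move: le1; rewrite leq_eqVlt ltnS leqn0 => /orP[/cards1P[t eqt]|/eqP e0].
  have ft : 3 %| f t.
    by have := finset.set11 t; rewrite -eqt inE.
  rewrite cardT eqt cards1 addn1; apply: leq_trans (leq_bin3_halvesS _ _) _.
  rewrite -cardU -(card_mixed_triples _ ft).
  have /eqP <- : #|triples_in (residue_class 1) :|: triples_in (residue_class 2)
      :|: mixed_triples t|%SET ==
    #|triples_in (residue_class 1) :|: triples_in (residue_class 2)|%SET
      + #|mixed_triples t|.
    rewrite leq_card_setU -finset.setI_eq0 finset.setIUl.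
    by rewrite !disjoint_setI0 ?finset.setU0 ?disjoint_mixed_triples.
  by rewrite subset_leq_card// finset.subUset subU mixed_triples_zero_sum.
rewrite cardT e0 addn0; apply: leq_trans (leq_bin3_halves _ _) _.
by rewrite -cardU subset_leq_card.
Qed.

End ZeroSumTriples.

Local Open Scope classical_set_scope.

Lemma TT_dvd3 (x : nat) : TT x -> 3 %| x -> x = 3.
Proof.
by move=> [//|[_ nx]] /dvdnP[k xE]; case: nx; exists k => //; rewrite mulnC.
Qed.

(** Every element of the sum set is the sum of some 3-subset of [A] in [good]. Several subsets may
    share a sum, so counting [good] gives an upper bound. *)
Lemma card_sum_set_leq (M : set nat) (A : {fset nat}) : M `<=` TT ->
  [set` A] `<=` M ->
  #|` fset_set (sum_set M A)| <=
  'C(#|` A|, 3) - 'C(#|` A|./2, 3) - 'C(uphalf #|` A|, 3).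
Proof.
move=> M_TT A_M.
have A_TT x : x \in A -> TT x by move=> /A_M /M_TT.
pose f (x : A) := val x.
pose triples : {set {set A}} := [set X : {set A} | #|X| == 3]%SET.
pose good : {set {set A}} := (triples :\: zero_sum_triples _ f)%SET.
have le_zero : 'C(#|` A|./2, 3) + 'C(uphalf #|` A|, 3) <= #|zero_sum_triples _ f|.
  rewrite cardfE; apply: leq_card_zero_sum_triples.
  apply/card_le1_eqP => x y; rewrite !inE => fx fy; apply: val_inj => /=.
  have /TT_dvd3 -> // := A_TT _ (valP x).
  by have /TT_dvd3 -> // := A_TT _ (valP y).
have card_good : #|good| = 'C(#|` A|, 3) - #|zero_sum_triples _ f|.
  rewrite cardsDS; last by apply/fintype.subsetP => X; rewrite !inE => /andP[].
  by rewrite cardfE -cardsT -cards_draws; congr (_ - _); apply: eq_card => X;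
    rewrite !inE finset.subsetT.
have sub_good : (fset_set (sum_set M A) `<=`
    [fset \sum_(x in (X : {set A})) f x | X in good])%fset.
  apply/fsubsetP => s; rewrite in_fset_set; last exact: finite_sum_set.
  rewrite inE => -[Ms /= [a [b [c [[aA bA cA] [/andP[ab bc] sE]]]]]].
  have abc : [` aA]%fset \notin [set [` bA]%fset; [` cA]%fset]%SET.
    by rewrite !inE -!val_eqE /=; lia.
  have bc' : [` bA]%fset \notin [set [` cA]%fset]%SET.
    by rewrite !inE -!val_eqE /=; lia.
  have sumE : \sum_(x in [set [` aA]%fset; [` bA]%fset; [` cA]%fset]%SET) f x = s.
    by rewrite -finset.setUA big_setU1//= big_setU1//= big_set1 sE /f /= addnA.
  apply/imfsetP; exists [set [` aA]%fset; [` bA]%fset; [` cA]%fset]%SET => //=.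
  rewrite !inE sumE -finset.setUA cardsU1 abc cardsU1 bc' cards1 /= andbT.
  apply/negP => /(TT_dvd3 _ (M_TT _ Ms)) s3.
  (* As a multiple of 3 other than 3, the number 0 is not in [TT]. Hence [a + b + c] is at least 6,
     against [s3]. *)
  have a_gt0 : 0 < a.
    by case: a aA {abc sumE} ab sE => // /A_TT/TT_dvd3; lia.
  lia.
(* Merging the two truncated subtractions lets [le_zero] bound the subtracted total at once. *)
rewrite -subnDA; apply: leq_trans (fsubset_leq_card sub_good) _.
apply: leq_trans (leq_imfset_card _ _ _) _.
by rewrite -[X in X <= _]cardE card_good leq_sub2l.
Qed.

Theorem proposition1 (M : set nat) (M_neq0 : M !=set0) (M_sub : M `<=` TT)
    (n : nat) :
  smax M n <= 'C(n, 3) - 'C(n./2, 3) - 'C(uphalf n, 3).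
Proof.
(* Without a subset of size [n] the maximum is 0 by convention; otherwise some [A] attains it. *)
have [E0|/set0P/smax_max[[A [A_M <-] <-] _]] := eqVneq (sum_cards M n) set0.
  by rewrite smax_empty.
exact: card_sum_set_leq.
Qed.
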